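(* Let $t\ge 2$ be an integer. If $G$ is an induced-subgraph-minimal graph having a pivot-minor isomorphic to $K_{1,t}$, then $|V(G)|\le (t^2-1)(2^{t+1}-t-3)+2t+2$.
   Context: Graphs are finite, without loops or multiple edges. $K_{1,t}$ is the star with $t$ leaves. For a vertex $u$ of a graph $G$, the local complementation $G*u$ is obtained from $G$ by complementing the adjacency between every pair of distinct neighbours of $u$. For an edge $uv$ of $G$, the edge pivot is $G\wedge uv=((G*u)*v)*u$. A graph $G$ contains $H$ as a pivot-minor if $H$ can be obtained from $G$ by a sequence of vertex deletions and edge pivots. A graph $G$ is an induced-subgraph-minimal graph having a pivot-minor isomorphic to $H$ if $G$ has a pivot-minor isomorphic to $H$ but no proper induced subgraph of $G$ does. *)

(* Defs.v *)
From mathcomp Require Import all_boot.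

Set Implicit Arguments.
Unset Strict Implicit.
Unset Printing Implicit Defensive.

Record sgraph := SGraph {
  vertex :> finType;
  edge : rel vertex;
  edge_sym : symmetric edge;
  edge_irrefl : irreflexive edge }.

Definition isomorphic (G H : sgraph) : Prop :=
  exists2 f : G -> H, bijective f & forall x y : G, edge (f x) (f y) = edge x y.

Section Operations.
Variable G : sgraph.

Definition induced_rel (A : {set G}) : rel {x : G | x \in A} :=
  fun x y => edge (val x) (val y).

Fact induced_sym (A : {set G}) : symmetric (@induced_rel A).
Proof. by move=> x y; apply: edge_sym. Qed.

Fact induced_irrefl (A : {set G}) : irreflexive (@induced_rel A).
Proof. by move=> x; apply: edge_irrefl. Qed.

Definition induced (A : {set G}) : sgraph :=
  SGraph (@induced_sym A) (@induced_irrefl A).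

Definition del_vertex (v : G) : sgraph := induced [set~ v].

Definition local_compl_rel (u : G) : rel G :=
  fun x y => if [&& x != y, edge u x & edge u y] then ~~ edge x y else edge x y.

Fact local_compl_sym (u : G) : symmetric (local_compl_rel u).
Proof.
by move=> x y; rewrite /local_compl_rel eq_sym (edge_sym x) [edge u x && _]andbC.
Qed.

Fact local_compl_irrefl (u : G) : irreflexive (local_compl_rel u).
Proof. by move=> x; rewrite /local_compl_rel eqxx edge_irrefl. Qed.

Definition local_compl (u : G) : sgraph :=
  SGraph (local_compl_sym u) (local_compl_irrefl u).

End Operations.

(* [local_compl] keeps the vertex type, so [u] and [v] are again vertices of
   the intermediate graphs. The term is meaningful as a pivot only when [u] and
   [v] are adjacent, which is required where it is used. *)
Definition pivot (G : sgraph) (u v : G) : sgraph :=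
  @local_compl (@local_compl (@local_compl G u) v) u.

(* [pivot_minor K G]: [K] is obtained from [G] by vertex deletions and edge
   pivots. A deletion changes the vertex type, so a minor is compared with a
   prescribed graph only up to isomorphism, in [has_pivot_minor]. *)
Inductive pivot_minor (K : sgraph) : sgraph -> Prop :=
| PivotMinorRefl : pivot_minor K K
| PivotMinorDel (G : sgraph) (v : G) :
    pivot_minor K (del_vertex v) -> pivot_minor K G
| PivotMinorPivot (G : sgraph) (u v : G) :
    edge u v -> pivot_minor K (pivot u v) -> pivot_minor K G.

Definition has_pivot_minor (G H : sgraph) : Prop :=
  exists2 K : sgraph, pivot_minor K G & isomorphic K H.

Definition induced_minimal (G H : sgraph) : Prop :=
  has_pivot_minor G H /\
  forall A : {set G}, A \proper [set: G] -> ~ has_pivot_minor (induced A) H.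

(* The star K_{1,t}: [None] is the centre, [Some i] are the leaves. *)
Definition star_rel (t : nat) : rel (option 'I_t) :=
  fun x y => (x == None) != (y == None).

Fact star_sym (t : nat) : symmetric (@star_rel t).
Proof. by move=> x y; rewrite /star_rel eq_sym. Qed.

Fact star_irrefl (t : nat) : irreflexive (@star_rel t).
Proof. by move=> x; rewrite /star_rel eqxx. Qed.

Definition star (t : nat) : sgraph := SGraph (@star_sym t) (@star_irrefl t).

(* Main.v *)
(** Let e be obtained from G by a sequence of edge pivots and let X be the set of
    vertices pivoted an odd number of times.  For v outside X the graph G - v is pivot-equivalent to e - v, and for v
    in X it is pivot-equivalent to (e /\ vz) - v for every neighbour z of v.
    Hence, when G is minimal, e - v (if v is not in X) and (e /\ vz) - v (if v
    is in X) have no K_{1,t} pivot-minor.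

    Let S be the vertex set of an induced K_{1,t} in e.  Pivoting on suitable
    edges shows that a vertex outside S is neither anticomplete nor complete to
    S, and that two vertices with the same neighbourhood in S are nonadjacent.
    So the vertices with a given neighbourhood P in S form, with each p in P, an
    induced star centred at p.  An induced star with more than t leaves forces X
    to be the complement of its centre, so all such stars share their centre.
    Moreover it has at most 2t leaves, since otherwise e itself would be a star,
    and G with it.  Hence every class has at most t vertices, which gives
    |V(G)| <= (2^{t+1} - 2) t + t + 1. *)

Require Import Defs.
From Stdlib Require Import FunctionalExtensionality.
From mathcomp Require Import all_boot zify.

Set Implicit Arguments.
Unset Strict Implicit.
Unset Printing Implicit Defensive.

Ltac split_at p q := case: (altP (p =P q)) => [?|/negbTE ?]; [subst p|].

Ltac split2 p x y := split_at p x; [|split_at p y].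
Ltac split4 p x y z t := split2 p x y; [| |split2 p z t].

Ltac use_ne := repeat match goal with
  | H : (?a == ?b) = false |- _ =>
    progress rewrite ?H ?[b == a]eq_sym ?H end.

Ltac edge_cases e es := repeat match goal with
  | |- context [e ?a ?b] => rewrite ?(es b a); case: (e a b) => //= end.

(** * Algebra of pivots on relations over a fixed vertex type *)

Section RelationPivot.
Variable V : finType.
Implicit Types (e : rel V) (a b u v x y z : V).

Definition swap u v x := if x == u then v else if x == v then u else x.

(* The Schur complement form of the pivot; as in [Defs.pivot], the labels of [u]
   and [v] are exchanged. *)
Definition piv e u v : rel V := fun x y =>
  if [|| x == u, x == v, y == u | y == v] then e (swap u v x) (swap u v y)
  else e x y (+) (e u x && e v y) (+) (e v x && e u y).

Lemma rel_ext e e' : e =2 e' -> e = e'.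
Proof.
move=> ee'; apply: functional_extensionality => x.
by apply: functional_extensionality.
Qed.

Lemma piv_sym e u v : symmetric e -> symmetric (piv e u v).
Proof.
move=> es x y; rewrite /piv (es (swap _ _ y)).
have -> : [|| y == u, y == v, x == u | x == v] =
          [|| x == u, x == v, y == u | y == v].
  by do 4 case: (_ == _).
by case: ifP => // _; edge_cases e es.
Qed.

Lemma piv_irr e u v : irreflexive e -> irreflexive (piv e u v).
Proof.
by move=> ei x; rewrite /piv !ei [e v x && _]andbC addbK if_same.
Qed.

Lemma pivL e u v x : u != v -> x != u -> x != v -> piv e u v u x = e v x.
Proof.
move=> uv /negbTE xu /negbTE xv.
by rewrite /piv /swap eqxx xu xv.
Qed.

Lemma pivR e u v x : u != v -> x != u -> x != v -> piv e u v v x = e u x.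
Proof.
move=> uv /negbTE xu /negbTE xv.
by rewrite /piv /swap eqxx orbT xu xv eq_sym (negbTE uv).
Qed.

Lemma piv_uv e u v : symmetric e -> u != v -> piv e u v u v = e u v.
Proof.
by move=> es uv; rewrite /piv /swap !eqxx /= eq_sym (negbTE uv) es.
Qed.

Lemma pivE e u v x y :
  x != u -> x != v -> y != u -> y != v ->
  piv e u v x y = e x y (+) (e u x && e v y) (+) (e v x && e u y).
Proof.
by move=> /negbTE xu /negbTE xv /negbTE yu /negbTE yv; rewrite /piv xu xv yu yv.
Qed.

Lemma pivC e u v : symmetric e -> piv e u v = piv e v u.
Proof.
have [-> //|/negbTE uv] := eqVneq u v.
move=> es; apply: rel_ext => x y; rewrite /piv /swap.
split2 x u v; split2 y u v; rewrite ?eqxx ?orbT //=; use_ne => //;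
  by edge_cases e es.
Qed.

Lemma pivK e u v : symmetric e -> irreflexive e -> e u v ->
  piv (piv e u v) u v = e.
Proof.
move=> es ei euv; apply: rel_ext => x y.
have uv : (u == v) = false by apply: contraTF euv => /eqP->; rewrite ei.
have evu : e v u by rewrite es.
split2 x u v; split2 y u v;
  rewrite /piv /swap; use_ne; rewrite ?eqxx ?orbT /= ?eqxx ?euv ?evu ?ei //=;
  use_ne; rewrite ?ei //; by edge_cases e es.
Qed.

(** Pivots on two edges at [y] thus differ by a pivot avoiding [y]: once [y] is deleted, the choice
    of its neighbour is immaterial. *)
Lemma piv_piv e x y z : symmetric e -> irreflexive e ->
  e x y -> e y z -> x != z -> piv (piv e x y) x z = piv e y z.
Proof.
move=> es ei exy eyz /negbTE xz; apply: rel_ext => p q.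
have xy : (x == y) = false by apply: contraTF exy => /eqP->; rewrite ei.
have yz : (y == z) = false by apply: contraTF eyz => /eqP->; rewrite ei.
have eyx : e y x by rewrite es.
have ezy : e z y by rewrite es.
split2 p x y; [| |split_at p z]; (split2 q x y; [| |split_at q z]);
  rewrite /piv /swap; use_ne;
  rewrite ?eqxx ?orbT /= ?eqxx ?eyz ?ezy ?exy ?eyx ?ei //=;
  use_ne; rewrite ?ei //.
all: edge_cases e es.
Qed.

(** Pivoting on [ab] leaves the neighbourhood of [v] unchanged, and pivoting on [vz] keeps the edge
    [ab]. *)
Lemma piv_comm e a b v z : symmetric e -> irreflexive e ->
  e a b -> e v z -> e v a = false -> e v b = false ->
  piv (piv e a b) v z = piv (piv e v z) a b.
Proof.
move=> es ei eab evz eva evb; apply: rel_ext => p q.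
have ab : (a == b) = false by apply: contraTF eab => /eqP->; rewrite ei.
have vz : (v == z) = false by apply: contraTF evz => /eqP->; rewrite ei.
have va : (v == a) = false by apply: contraFF evb => /eqP->.
have vb : (v == b) = false by apply: contraFF eva => /eqP->; rewrite es.
have za : (z == a) = false by apply: contraTF evz => /eqP->; rewrite eva.
have zb : (z == b) = false by apply: contraTF evz => /eqP->; rewrite evb.
have eba : e b a by rewrite es.
have ezv : e z v by rewrite es.
have eav : e a v = false by rewrite es.
have ebv : e b v = false by rewrite es.
split4 p a b v z; split4 q a b v z;
  rewrite /piv /swap; use_ne;
  rewrite ?eqxx ?orbT /= ?eqxx ?eab ?eba ?evz ?ezv ?eva ?eav ?evb ?ebv
    ?ei //=;
  use_ne; rewrite ?ei //.
all: edge_cases e es.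
Qed.

End RelationPivot.

(** * Transfer between graphs and relations on one type *)

Lemma edge_pivot (G : sgraph) (u v : G) : edge u v ->
  forall x y, @edge (pivot u v) x y = piv (@edge G) u v x y.
Proof.
move=> euv x y; have es := @edge_sym G; have ei := @edge_irrefl G.
have uv : (u == v) = false by apply: contraTF euv => /eqP->; rewrite ei.
have evu : edge v u by rewrite es.
rewrite /pivot /= /local_compl_rel /= /local_compl_rel /= /local_compl_rel /piv /swap.
split2 x u v; split2 y u v; use_ne;
  rewrite ?eqxx ?euv ?evu ?ei /= ?eqxx ?orbT ?andbT ?andbF ?euv ?evu ?ei //=; use_ne;
  rewrite ?ei //=; try by edge_cases (@edge G) es.
case: (altP (x =P y)) => [->|?]; last by edge_cases (@edge G) es.
by rewrite ei; edge_cases (@edge G) es.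
Qed.

Lemma piv_inj (U V : finType) (f : U -> V) (e : rel V) (d : rel U) (u v : U) :
  injective f -> (forall x y, d x y = e (f x) (f y)) ->
  forall x y, piv d u v x y = piv e (f u) (f v) (f x) (f y).
Proof.
move=> fi de x y; rewrite /piv /swap !(inj_eq fi) !de.
by do !case: (_ == _).
Qed.

Definition embeds (H : sgraph) (V : finType) (e : rel V) (f : H -> V) :=
  injective f /\ forall x y, edge x y = e (f x) (f y).

Lemma embeds_piv (H : sgraph) (V : finType) (e : rel V) (f : H -> V) (u v : H) :
  edge u v -> embeds e f ->
  @embeds (pivot u v) V (piv e (f u) (f v)) f.
Proof.
move=> euv [fi fe]; split=> // x y; rewrite edge_pivot //.
exact: piv_inj.
Qed.

Lemma embeds_val (H : sgraph) (A : {set H}) (V : finType) (e : rel V)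
  (f : H -> V) : embeds e f -> @embeds (induced A) V e (f \o val).
Proof.
by case=> fi fe; split=> [x y /fi/val_inj | x y] //; exact: fe.
Qed.

(** Vertices outside the image of [g] are deleted one at a time until [g] is bijective. *)
Lemma has_pivot_minor_induced (K H : sgraph) (g : K -> H) :
  embeds (@edge H) g -> has_pivot_minor H K.
Proof.
have [n] := ubnP #|H|; elim: n H g => // n IH H g /ltnSE leHn [gi ge].
have [/forallP gs|] := boolP [forall x, x \in codom g].
  have gK y : g (iinv (gs y)) = y by exact: f_iinv.
  exists H; first exact: PivotMinorRefl.
  exists (fun y => iinv (gs y)) => [|x y]; last by rewrite ge !gK.
  by exists g => // x; apply: gi; rewrite gK.
case/forallPn => v vg.
have gv x : g x \in [set~ v].
  by rewrite !inE; apply: contraNneq vg => <-; exact: codom_f.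
have [||K' K'm K'i] := IH (del_vertex v) (fun x => Sub (g x) (gv x)).
- rewrite card_sig (@eq_card _ _ (mem [set~ v])) // cardsC1.
  apply: leq_trans leHn; rewrite ltn_predL.
  by apply/card_gt0P; exists v.
- split=> [x y /(congr1 val) /= /gi //|x y]; exact: ge.
by exists K' => //; apply: PivotMinorDel K'm.
Qed.

(** * Minimality carried through pivots *)

Section Tracking.
Variables (t : nat) (V : finType).
Implicit Types (e : rel V) (a b c u v x y z : V) (D L X : {set V}).

(** Quantifying over all graphs embedded onto [D] avoids fixing a vertex type for the subgraph
    induced on [D]. *)
Definition star_minor_on D e :=
  forall (H : sgraph) (f : H -> V),
    embeds e f -> (forall x, (x \in D) = (x \in codom f)) ->
    has_pivot_minor H (star t).

Lemma star_minor_on_piv D e u v : u \in D -> v \in D -> e u v ->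
  star_minor_on D (piv e u v) -> star_minor_on D e.
Proof.
move=> uD vD euv De H f ef fD.
move: uD vD; rewrite !fD => /codomP[u' Eu] /codomP[v' Ev]; subst u v.
have e'uv : edge u' v' by rewrite (proj2 ef).
have [K Km Ki] := De (pivot u' v') f (embeds_piv e'uv ef) fD.
by exists K => //; apply: PivotMinorPivot Km.
Qed.

Definition induced_star e c L :=
  (forall l, l \in L -> e c l) /\
  (forall l l', l \in L -> l' \in L -> e l l' = false).

Lemma star_minor_on_star D e c L : symmetric e -> irreflexive e ->
  induced_star e c L -> t <= #|L| -> c \in D -> L \subset D ->
  star_minor_on D e.
Proof.
move=> es ei [ecL eL] tL cD /subsetP LD H f [fi fe] fD.
have c'P : c \in codom f by rewrite -fD.
have l'P (i : 'I_t) : enum_val (widen_ord tL i) \in codom f.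
  by rewrite -fD LD // enum_valP.
pose g (x : star t) : H := if x is Some i then iinv (l'P i) else iinv c'P.
apply: (@has_pivot_minor_induced _ _ g); split.
  have cl i : iinv (l'P i) <> iinv c'P.
    move=> /(congr1 f); rewrite !f_iinv => E.
    by have := ecL _ (enum_valP (widen_ord tL i)); rewrite E ei.
  move=> [i|] [j|] //= => [|/cl //|/esym/cl //].
  move=> /(congr1 f); rewrite !f_iinv => /enum_val_inj/(congr1 val) /= ij.
  by congr Some; exact: val_inj.
move=> [i|] [j|]; rewrite fe /= !f_iinv.
- by rewrite eL ?enum_valP.
- by rewrite es ecL ?enum_valP.
- by rewrite ecL ?enum_valP.
- by rewrite ei.
Qed.

Definition spanning_star e c := forall x y, e x y = (x == c) (+) (y == c).

Definition toggle X a b : {set V} :=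
  [set x | (x \in X) (+) ((x == a) || (x == b))].

(* [X] is the set of vertices pivoted an odd number of times. The last two fields
   are what is needed of the nonsingularity of the adjacency matrix of [e] on [X]:
   no isolated vertex lies in [X], and [X] is not the leaf set of a spanning
   star. *)
Record tracked e X : Prop := Tracked {
  tracked_sym : symmetric e;
  tracked_irr : irreflexive e;
  tracked_del : forall v, v \notin X -> ~ star_minor_on [set~ v] e;
  tracked_contract : forall v z, v \in X -> e v z ->
    ~ star_minor_on [set~ v] (piv e v z);
  tracked_nbr : forall v, v \in X -> exists z, e v z;
  tracked_span : forall c l, l != c -> spanning_star e c -> X = [set~ c] -> False
}.

Lemma edge_neq e x y : irreflexive e -> e x y -> x != y.
Proof. by move=> ei; apply: contraTneq => ->; rewrite ei. Qed.

Lemma toggleC X a b : toggle X a b = toggle X b a.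
Proof. by apply/setP => x; rewrite !inE orbC. Qed.

Lemma spanning_star_piv e c b : symmetric e -> irreflexive e -> b != c ->
  spanning_star e c -> spanning_star (piv e c b) b.
Proof.
move=> es ei bc eS x y.
have := bc; rewrite eq_sym => cb.
rewrite /piv /swap !eS; move/negbTE: bc => bc; move/negbTE: cb => cb.
split2 x c b; split2 y c b; use_ne;
  by rewrite ?eqxx ?orbT /= ?eqxx ?bc //=; use_ne.
Qed.

(** Each case rewrites the double pivot as [e] or one pivot of [e] at [v], up to a pivot avoiding
    [v]. *)
Lemma tracked_piv_contract e X a b v z : tracked e X -> e a b ->
  v \in toggle X a b -> piv e a b v z ->
  ~ star_minor_on [set~ v] (piv (piv e a b) v z).
Proof.
move=> [es ei eD eC eN _] eab.
have ab := edge_neq ei eab; have eba : e b a by rewrite es.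
(* [v] is an endpoint: the pivots cancel, or collapse to one avoiding [v]. *)
have case_end a' b' z' : e a' b' -> a' != b' -> a' \notin X ->
   piv e a' b' a' z' -> ~ star_minor_on [set~ a'] (piv (piv e a' b') a' z').
  move=> e'ab ab' aX e1az; have [zb|zb] := eqVneq z' b'.
    by rewrite zb pivK //; exact: eD.
  have az : z' != a' by rewrite eq_sym (edge_neq (piv_irr _ _ ei) e1az).
  have ebz : e b' z' by rewrite -(pivL e ab' az zb).
  rewrite piv_piv //; last by rewrite eq_sym.
  move/(star_minor_on_piv _ _ ebz) => H; apply: (eD _ aX); apply: H;
    by rewrite !inE // eq_sym.
(* [z] is an endpoint: the pivots collapse to one on [v] and the other endpoint. *)
have case_nbr a' b' v' : e a' b' -> a' != b' -> v' != a' -> v' != b' ->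
   v' \in X -> piv e a' b' v' a' -> ~ star_minor_on [set~ v'] (piv (piv e a' b') v' a').
  move=> e'ab ab' va vb vX; rewrite piv_sym // pivL // => ebv.
  rewrite (pivC v') ?piv_piv ?(pivC b') 1?eq_sym //; last exact: piv_sym.
  by apply: eC; rewrite // es.
(* A general [z] is exchanged for the neighbour [a'] by a pivot avoiding [v]. *)
have case_mid a' b' v' z' : e a' b' -> a' != b' -> v' != a' -> v' != b' ->
   v' \in X -> piv e a' b' v' z' -> piv e a' b' v' a' ->
   ~ star_minor_on [set~ v'] (piv (piv e a' b') v' z').
  move=> e'ab ab' va vb vX e1vz e1va.
  have [->|za] := eqVneq z' a'; first exact: case_nbr.
  have e1s := piv_sym a' b' es; have e1i := piv_irr a' b' ei.
  have e1av : piv e a' b' a' v' by rewrite e1s.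
  rewrite -(@piv_piv _ _ a') //; last by rewrite eq_sym.
  move/star_minor_on_piv => H; apply: (case_nbr a' b' v') => //.
  rewrite (pivC v') //; apply: H.
  - by rewrite !inE eq_sym.
  - by rewrite !inE eq_sym (edge_neq e1i e1vz).
  - by rewrite pivL // 1?eq_sym // (edge_neq e1i e1vz).
rewrite inE; have [->|va] := eqVneq v a.
  by rewrite addbT => aX; exact: case_end.
have [->|vb] := eqVneq v b.
  by rewrite addbT (pivC a) // => bX; apply: case_end; rewrite // eq_sym.
rewrite addbF => vX e1vz.
have [e1va|e1va] := boolP (piv e a b v a); first exact: case_mid.
have [e1vb|e1vb] := boolP (piv e a b v b).
  by rewrite (pivC a) // in e1vz e1vb *; apply: case_mid; rewrite // eq_sym.
(* [v] now sees neither endpoint, so the two pivots commute. *)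
have e1s := piv_sym a b es.
have evb : e v b = false by rewrite es -(pivL e ab va vb) e1s; exact: negbTE.
have eva : e v a = false by rewrite es -(pivR e ab va vb) e1s; exact: negbTE.
have za : z != a by apply: contraTneq e1vz => ->.
have zb : z != b by apply: contraTneq e1vz => ->.
have evz : e v z.
  by move: e1vz; rewrite pivE // (es a v) (es b v) eva evb !addbF.
rewrite piv_comm // => /star_minor_on_piv H; apply: (eC _ _ vX evz).
apply: H; first by rewrite !inE eq_sym.
  by rewrite !inE eq_sym.
have vz := edge_neq ei evz.
by rewrite pivE 1?eq_sym // eva evb eab !andbF.
Qed.

(** The deletion and contraction conditions trade places at [a] and [b] and stay put elsewhere. *)
Lemma tracked_piv e X a b : tracked e X -> e a b ->
  tracked (piv e a b) (toggle X a b).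
Proof.
move=> tr eab; have [es ei eD eC eN eF] := tr.
have ab := edge_neq ei eab; have eba : e b a by rewrite es.
have e1s := piv_sym a b es; have e1i := piv_irr a b ei.
have e1ab : piv e a b a b by rewrite piv_uv.
split=> //.
- move=> v; rewrite inE; have [->|va] := eqVneq v a.
    by rewrite addbT negbK => aX; exact: eC.
  have [->|vb] := eqVneq v b.
    by rewrite addbT negbK (pivC a) // => bX; exact: eC.
  rewrite addbF => vX /star_minor_on_piv H; apply: (eD _ vX).
  by apply: H; rewrite ?inE 1?eq_sym.
- by move=> v z; exact: tracked_piv_contract.
- move=> v; rewrite inE; have [->|va] := eqVneq v a; first by exists b.
  have [->|vb] := eqVneq v b; first by exists a; rewrite e1s.
  rewrite addbF => vX.
  have [eva|/negbTE eva] := boolP (e v a).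
    by exists b; rewrite e1s pivR // es.
  have [evb|/negbTE evb] := boolP (e v b).
    by exists a; rewrite e1s pivL // es.
  have [z evz] := eN _ vX; exists z.
  rewrite pivE //; first by rewrite (es a v) (es b v) eva evb evz.
    by apply: contraTneq evz => ->; rewrite eva.
  by apply: contraTneq evz => ->; rewrite evb.
(* The centre is [a] or [b]. Pivoting back moves it to the other endpoint, whose complement must
   already have been [X]. *)
- move=> c l lc eS X1.
  have main a' b' : e a' b' -> spanning_star (piv e a' b') a' ->
      toggle X a' b' = [set~ a'] -> False.
    move=> e'ab eS' X1'; have ab' := edge_neq ei e'ab.
    apply: (eF b' a' ab').
      rewrite -(pivK es ei e'ab); apply: spanning_star_piv => //.
      - exact: piv_sym.
      - exact: piv_irr.
      - by rewrite eq_sym.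
    apply/setP => x; move/setP: X1' => /(_ x); rewrite !inE.
    have [->|xa] := eqVneq x a'.
      by rewrite ab' addbT => /negbFE.
    by case: (x \in X); case: (x == b').
  have := e1ab; rewrite eS; have [ac _|ac] := eqVneq a c.
    by subst c; exact: (main a b).
  have [bc _|//] := eqVneq b c.
  by subst c; apply: (main b a); rewrite // 1?toggleC // pivC.
Qed.
End Tracking.

(** * Vertices outside an induced star with at least [t] leaves *)

Section Stars.
Variables (t : nat) (V : finType) (e : rel V) (X : {set V}).
Hypothesis tr : tracked t e X.
Implicit Types (c l v y z : V) (L : {set V}).

Let es := tracked_sym tr.
Let ei := tracked_irr tr.

Lemma induced_starS c L L' : L' \subset L -> induced_star e c L ->
  induced_star e c L'.
Proof.
by move=> /subsetP sL [ecL eL]; split=> [l /sL/ecL //|l l' /sL lL /sL]; exact: eL.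
Qed.

Lemma centre_notin c L : induced_star e c L -> c \notin L.
Proof. by case=> ecL _; apply/negP => /ecL; rewrite ei. Qed.

Lemma outside_star c L v : induced_star e c L -> t <= #|L| -> v \notin c |: L ->
  v \in X.
Proof.
rewrite !inE negb_or => st tL /andP[vc vL].
apply/contraT => /(tracked_del tr) []; apply: star_minor_on_star st tL _ _ => //.
  by rewrite !inE eq_sym.
by apply/subsetP => l lL; rewrite !inE; apply: contraNneq vL => <-.
Qed.

Lemma piv_star_false c L v z : v \in X -> e v z -> v \notin c |: L ->
  induced_star (piv e v z) c L -> t <= #|L| -> False.
Proof.
rewrite !inE negb_or => vX evz /andP[vc vL] st tL.
apply: (tracked_contract tr vX evz); apply: star_minor_on_star st tL _ _.
- exact: piv_sym.
- exact: piv_irr.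
- by rewrite !inE eq_sym.
by apply/subsetP => l lL; rewrite !inE; apply: contraNneq vL => <-.
Qed.

(** The hypothesis makes the two correction terms of the pivot cancel on the star. *)
Lemma induced_star_piv c L y z : y \notin c |: L -> z \notin c |: L ->
  (forall s s', s \in c |: L -> s' \in c |: L ->
     e y s && e z s' = e z s && e y s') ->
  induced_star e c L -> induced_star (piv e y z) c L.
Proof.
move=> yS zS yz [ecL eL].
have yN s : s \in c |: L -> s != y by move=> sS; apply: contraNneq yS => <-.
have zN s : s \in c |: L -> s != z by move=> sS; apply: contraNneq zS => <-.
have E s s' : s \in c |: L -> s' \in c |: L -> piv e y z s s' = e s s'.
  by move=> sS s'S; rewrite pivE ?yN ?zN // yz // addbK.
have LS l : l \in L -> l \in c |: L by move=> lL; rewrite inE lL orbT.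
split=> [l lL|l l' lL l'L]; rewrite E ?setU11 ?LS //; [exact: ecL|exact: eL].
Qed.

(** Some neighbour [z] of [y] exists outside the star, and pivoting on [yz] preserves the star. *)
Lemma outside_has_nbr c L y : induced_star e c L -> t <= #|L| ->
  y \notin c |: L -> (forall s, s \in c |: L -> e y s = false) -> False.
Proof.
move=> st tL yS y0; have yX := outside_star st tL yS.
have [z eyz] := tracked_nbr tr yX.
have zS : z \notin c |: L by apply: contraTN eyz => /y0->.
apply: (piv_star_false yX eyz yS _ tL); apply: induced_star_piv => // s s' sS s'S.
by rewrite !y0 // andbF.
Qed.

(** Pivoting on [yc] gives [c] the neighbours of [y] and toggles each pair of leaves twice. *)
Lemma outside_not_full c L y : induced_star e c L -> t <= #|L| ->
  y \notin c |: L -> (forall s, s \in c |: L -> e y s) -> False.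
Proof.
move=> st tL yS y1; have yX := outside_star st tL yS.
have eyc : e y c by rewrite y1 ?setU11.
apply: (piv_star_false yX eyc yS _ tL).
have yc := edge_neq ei eyc; have cL := centre_notin st.
have lc l : l \in L -> l != c by apply: contraTneq => ->.
have ly l : l \in L -> l != y.
  by apply: contraTneq => ->; apply: contraNN yS; rewrite inE orbC => ->.
have LS l : l \in L -> l \in c |: L by move=> lL; rewrite inE lL orbT.
case: st => ecL eL.
split=> [l lL|l l' lL l'L]; first by rewrite (pivR e yc (ly l lL) (lc l lL)) y1 // LS.
by rewrite pivE ?lc ?ly // eL // !y1 ?LS // !ecL.
Qed.

Lemma same_type_nonadjacent c L y z : induced_star e c L -> t <= #|L| ->
  y \notin c |: L -> z \notin c |: L ->
  (forall s, s \in c |: L -> e y s = e z s) -> e y z = false.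
Proof.
move=> st tL yS zS yz; apply/negP => eyz; have yX := outside_star st tL yS.
apply: (piv_star_false yX eyz yS _ tL); apply: induced_star_piv => // s s' sS s'S.
by rewrite !yz.
Qed.

(** With a leaf to spare, even a leaf lies outside a star with [t] leaves. *)
Lemma large_star_others c L v : induced_star e c L -> t < #|L| -> v != c ->
  v \in X.
Proof.
move=> st tL vc; apply: (@outside_star c (L :\ v)).
- by apply: induced_starS st; exact: subD1set.
- by move: tL; rewrite (cardsD1 v L); case: (v \in L) => /=; lia.
- by rewrite !inE negb_or vc eqxx.
Qed.
End Stars.

Lemma swap_star (V : finType) (e : rel V) c l (L : {set V}) :
  symmetric e -> irreflexive e ->
  induced_star e c L -> l \in L -> induced_star (piv e c l) l (c |: L :\ l).
Proof.
move=> es ei [ecL eL] lL; have ecl := ecL _ lL; have cl := edge_neq ei ecl.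
have lc' s : s \in L -> s != c.
  by move=> sL; rewrite eq_sym (edge_neq ei (ecL _ sL)).
split=> [s|s s']; rewrite !inE.
  case/orP => [/eqP->|/andP[sl sL]]; first by rewrite piv_sym // piv_uv.
  by rewrite pivR ?ecL // lc'.
move=> /orP[/eqP->|/andP[sl sL]] /orP[/eqP->|/andP[sl' sL']].
- exact: piv_irr.
- by rewrite pivL ?eL // lc'.
- by rewrite piv_sym // pivL ?eL // lc'.
- by rewrite pivE ?lc' // !(eL l) // eL // andbF.
Qed.

(** * Large stars, and counting vertices by their neighbourhood in a star *)

Section Bound.
Variables (t : nat) (V : finType) (e : rel V) (X : {set V}).
Hypothesis t2 : 2 <= t.
Hypothesis tr : tracked t e X.
Implicit Types (c l v y z : V) (L : {set V}).

Let es := tracked_sym tr.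
Let ei := tracked_irr tr.

(** To exclude [c], pivot on [cl]: [c] becomes a leaf of an equally large star, so it lies in the
    toggled set. *)
Lemma large_star_set c L : induced_star e c L -> t < #|L| -> X = [set~ c].
Proof.
move=> st tL; apply/setP => v; rewrite !inE.
have [->|vc] := eqVneq v c; last exact: large_star_others st tL vc.
have /card_gt0P[l lL] : 0 < #|L| by lia.
have ecl : e c l by case: st => ecL _; exact: ecL.
have cl := edge_neq ei ecl.
have cL := centre_notin tr st.
have := large_star_others (tracked_piv tr ecl) (swap_star es ei st lL) _ cl.
rewrite cardsU1 !inE negb_and cL orbT eqxx /= addbT => H.
apply/negbTE/H; move: tL; rewrite (cardsD1 l L) lL; lia.
Qed.

Lemma large_star_centre c c' L L' : induced_star e c L -> t < #|L| ->
  induced_star e c' L' -> t < #|L'| -> c = c'.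
Proof.
move=> st tL st' tL'; have := large_star_set st tL.
by rewrite (large_star_set st' tL') => /setC_inj/set1_inj.
Qed.

Lemma star_leaves_bound c L : induced_star e c L -> #|L| <= t.*2.
Proof.
move=> st; rewrite leqNgt; apply/negP => L2t.
(* Enlarge the star by all neighbours of its centre anticomplete to its leaves. *)
wlog Lmax : L st L2t / forall y, e c y ->
    (forall l, l \in L -> e y l = false) -> y \in L.
  have [ecL eL] := st.
  pose M := [set y | e c y & [forall (l | l \in L), ~~ e y l]].
  have MP y : y \in M -> e c y /\ forall l, l \in L -> e y l = false.
    rewrite inE => /andP[ecy /forall_inP yL]; split=> // l /yL; exact: negbTE.
  have LM : L \subset M.
    by apply/subsetP => l lL; rewrite inE ecL //; apply/forall_inP => l' l'L; rewrite eL.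
  have stM : induced_star e c M.
    split=> [y /MP[]//|y z yM zM].
    have [yL|yL] := boolP (y \in L); first by rewrite es (proj2 (MP z zM)).
    have [zL|zL] := boolP (z \in L); first by rewrite (proj2 (MP y yM)).
    have [ecy ely] := MP y yM; have [ecz elz] := MP z zM.
    apply: (same_type_nonadjacent tr st (y := y) (z := z)).
    - by lia.
    - by rewrite !inE negb_or yL eq_sym (edge_neq ei ecy).
    - by rewrite !inE negb_or zL eq_sym (edge_neq ei ecz).
    - move=> s; rewrite !inE => /orP[/eqP->|sL]; first by rewrite !(es _ c) ecy.
      by rewrite ely // elz.
  move/(_ M stM); apply; first exact: leq_trans L2t (subset_leq_card LM).
  move=> y ecy yM; rewrite inE ecy; apply/forall_inP => l lL.
  by rewrite yM // (subsetP LM).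
have [ecL eL] := st.
have tL : t < #|L| by lia.
have XE := large_star_set st tL.
pose N y := [set l in L | e y l].
have NL y : N y \subset L by apply/subsetP => l; rewrite inE => /andP[].
have cN y : #|L :\: N y| = #|L| - #|N y|.
  by rewrite cardsD (setIidPr (NL y)).
have all_in y : y \in c |: L.
  apply/negPn/negP => yS.
  have yX := outside_star tr st (ltnW tL) yS.
  have := yS; rewrite !inE negb_or => /andP[yc yL].
  have [ecy|/negbTE ecy] := boolP (e c y).
    have Nt : #|N y| < t.
      rewrite ltnNge; apply/negP => Nt.
      apply: (outside_not_full tr (induced_starS (NL y) st) Nt (y := y)).
        by rewrite !inE (negbTE yc) (negbTE yL).
      by move=> s; rewrite !inE => /orP[/eqP->|/andP[] //]; rewrite es.
    have [l lL eyl] : exists2 l, l \in L & e y l.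
      apply/exists_inP; apply: contraNT yL => /exists_inPn yL.
      by apply: Lmax => // l /yL/negbTE.
    (* Pivoting on [yl] keeps [c] joined to the more than [t] nonneighbours of [y] in [L]. *)
    apply: (@piv_star_false _ _ _ _ tr c (L :\: N y) y l) => //.
    - by rewrite !inE (negbTE yc) (negbTE yL) andbF.
    - have lc : c != l := edge_neq ei (ecL _ lL).
      have LN s : s \in L :\: N y -> [/\ s \in L, e y s = false, s != y & s != l].
        rewrite !inE => /andP[]; case sL: (s \in L) => //= /negbTE eys _; split=> //.
          by apply: contraNneq yL => <-.
        by apply: contraFneq eys => ->.
      split=> [s /LN[sL eys sy sl]|s s' /LN[sL eys sy sl] /LN[sL' eys' sy' sl']].
        by rewrite pivE // 1?eq_sym // ecL // eys (eL l) // !andbF.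
      by rewrite pivE // eL // eys eys' andbF.
    - by rewrite cN; lia.
  (* Many neighbours make [y] a second large centre; few leave [y] anticomplete to a star. *)
  have [Nt|Nt] := leqP t.+1 #|N y|.
    case/eqP: yc; apply: (large_star_centre (L := N y) (L' := L)) => //.
    split=> [l|l l' /(subsetP (NL y)) lL /(subsetP (NL y))]; last exact: eL.
    by rewrite inE => /andP[].
  have LN : L :\: N y \subset L := subsetDl _ _.
  case: (outside_has_nbr tr (induced_starS LN st) (y := y)).
  - by rewrite cN; lia.
  - by rewrite !inE (negbTE yc) (negbTE yL) andbF.
  - move=> s; rewrite !inE => /orP[/eqP->|]; first by rewrite es.
    by case/andP; case: (s \in L) => //= /negbTE.
(* Now [e] is a spanning star and [X] the complement of its centre, contradicting [tracked_span]. *)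
have /card_gt0P[l lL] : 0 < #|L| by lia.
have cL := centre_notin tr st.
apply: (tracked_span tr (c := c) (l := l)) XE; first by apply: contraNneq cL => <-.
move=> x y; have := all_in y; have := all_in x; rewrite !inE.
have [->|xc] := eqVneq x c; have [->|yc] := eqVneq y c => /=.
- by rewrite ei.
- by move=> _ /ecL.
- by rewrite es => /ecL.
- exact: eL.
Qed.

(** A larger class is the leaf set of a star at each vertex of [P]; the common centre forces [P] to
    be a singleton. *)
Lemma type_class_bound c L (P : {set V}) : induced_star e c L -> #|L| = t ->
  P != set0 ->
  #|[set y in ~: (c |: L) | [set s in c |: L | e y s] == P]| <= t.
Proof.
move=> st tL P0; set C := [set y in _ | _].
have tL' : t <= #|L| by rewrite tL.
have CP y s : y \in C -> s \in c |: L -> e y s = (s \in P).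
  by rewrite inE => /andP[_ /eqP <-] sS; rewrite inE sS.
have CS y : y \in C -> y \notin c |: L by rewrite !inE => /andP[].
have C0 y z : y \in C -> z \in C -> e y z = false.
  move=> yC zC; apply: (same_type_nonadjacent tr st tL'); rewrite ?CS //.
  by move=> s sS; rewrite !CP.
rewrite leqNgt; apply/negP => tC.
have /card_gt0P[y0 y0C] : 0 < #|C| by lia.
have PS p : p \in P -> p \in c |: L.
  by move: y0C; rewrite inE => /andP[_ /eqP <-]; rewrite inE => /andP[].
have stP p : p \in P -> induced_star e p C.
  by move=> pP; split=> // y yC; rewrite es CP // PS.
have [p pP] := set0Pn _ P0.
have PE q : q \in P -> q = p.
  by move=> qP; apply: (large_star_centre (stP q qP) tC (stP p pP) tC).
(* If [p] is [c], then [L] and the class form a star with more than [2t] leaves. *)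
have [pc|pc] := eqVneq p c.
  subst p.
  have CL : [disjoint L & C].
    rewrite disjoint_subset; apply/subsetP => l lL; rewrite inE.
    by apply/negP => /CS; rewrite inE lL orbT.
  have stU : induced_star e c (L :|: C).
    have CL0 l y : l \in L -> y \in C -> e y l = false.
      move=> lL yC; rewrite CP // ?inE ?lL ?orbT //.
      by apply: contraNF (centre_notin tr st) => /PE <-.
    case: st => ecL eL; case: (stP c pP) => ecC _; split.
      by move=> l; rewrite inE => /orP[/ecL|/ecC].
    move=> l l'; rewrite !in_setU => /orP[lL|lC] /orP[lL'|lC'].
    - exact: eL.
    - by rewrite es CL0.
    - exact: CL0.
    - exact: C0.
  have := star_leaves_bound stU; rewrite cardsU disjoint_setI0 // cards0 tL; lia.
have pL : p \in L by have := PS p pP; rewrite !inE (negbTE pc).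
(* As [t >= 2], another leaf [q] exists; it sees neither [p] nor the class. *)
have /card_gt0P[q] : 0 < #|L :\ p| by have := cardsD1 p L; rewrite pL; lia.
rewrite !inE => /andP[qp qL].
have qS : q \in c |: L by rewrite inE qL orbT.
apply: (outside_has_nbr tr (stP p pP) (ltnW tC) (y := q)).
  by rewrite !inE (negbTE qp) qL orbT.
move=> s; rewrite inE => /orP[|sC].
  by rewrite inE => /eqP->; case: st => _ ->.
by rewrite es CP //; apply: contraNF qp => /PE ->.
Qed.

Lemma tracked_card_bound c L : induced_star e c L -> #|L| = t ->
  #|V| <= (2 ^ t.+1 - 2) * t + t.+1.
Proof.
move=> st tL; set S := c |: L.
have tL' : t <= #|L| by rewrite tL.
have cS : #|S| = t.+1 by rewrite cardsU1 (centre_notin tr st) tL.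
rewrite -(cardsC S) cS addnC leq_add2r -sum1_card.
pose ty y := [set s in S | e y s].
pose D := powerset S :\ set0 :\ S.
have tyD y : y \in ~: S -> ty y \in D.
  rewrite inE => yS; rewrite !inE; apply/and3P; split.
  - apply/eqP => E; apply: (outside_not_full tr st tL' yS) => s sS.
    by move: (sS); rewrite -/S -{1}E inE => /andP[].
  - apply/eqP => E; apply: (outside_has_nbr tr st tL' yS) => s sS.
    by apply/negP => eys; have := in_set0 s; rewrite -E inE sS eys.
  - by apply/subsetP => s; rewrite inE => /andP[].
rewrite (partition_big ty (mem D)) //=.
have cD : #|D| = 2 ^ t.+1 - 2.
  have := cardsD1 S (powerset S :\ set0); have := cardsD1 set0 (powerset S).
  rewrite card_powerset cS !inE sub0set subxx -/D.
  have -> : S != set0 by rewrite -card_gt0 cS.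
  by move=> /=; lia.
rewrite -cD -sum_nat_const; apply: leq_sum => P; rewrite !inE => /and3P[_ P0 _].
by apply: leq_trans (type_class_bound st tL P0); rewrite sum1_card cardsE.
Qed.
End Bound.

(** * From a minimal graph to the bound *)

Lemma tracked_start (t : nat) (G : sgraph) :
  induced_minimal G (star t) -> tracked t (@edge G) set0.
Proof.
move=> [_ Gmin].
have noD (v : G) : ~ star_minor_on t [set~ v] (@edge G).
  move=> H; apply: (Gmin [set~ v]).
    by rewrite properT; apply/eqP => /setP/(_ v); rewrite !inE eqxx.
  apply: (H (induced [set~ v]) val); first by split=> // x y; exact: val_inj.
  move=> x; apply/idP/codomP => [xv|[y ->]]; last exact: (valP y).
  by exists (Sub x xv); rewrite SubK.
(* With [X] empty, membership conditions are vacuous, and [l] shows that the complement of [c] is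
   nonempty. *)
split=> [||v _|v z|v|c l lc _ /setP/(_ l)]; rewrite ?inE ?lc //.
- exact: edge_sym.
- exact: edge_irrefl.
Qed.

(** Deletions only restrict the embedding; pivots act on all of [V]. *)
Lemma pivot_minor_tracked (t : nat) (V : finType) (K H : sgraph) :
  pivot_minor K H -> forall (e : rel V) (X : {set V}) (f : H -> V),
    tracked t e X -> embeds e f ->
    exists e' X' (g : K -> V), tracked t e' X' /\ embeds e' g.
Proof.
elim=> {H} [|H v _ IH|H u v euv _ IH] e X f tr ef; first by exists e, X, f.
  exact: (IH e X (f \o val) tr (embeds_val _ ef)).
have fuv : e (f u) (f v) by rewrite -(proj2 ef).
exact: (IH _ _ f (tracked_piv tr fuv) (embeds_piv euv ef)).
Qed.

Lemma embeds_star (t : nat) (V : finType) (e : rel V) (g : star t -> V) :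
  embeds e g -> exists c L, induced_star e c L /\ #|L| = t.
Proof.
case=> gi ge; exists (g None), [set g (Some i) | i : 'I_t].
split; last by rewrite card_imset ?card_ord // => i j /gi[].
by split=> [_ /imsetP[i _ ->]|_ _ /imsetP[i _ ->] /imsetP[j _ ->]]; rewrite -ge.
Qed.

Lemma exp2_large t : 2 <= t -> t + 6 <= 2 ^ t.+1.
Proof.
elim: t => // -[//|[//|t]] IH _; have := IH isT.
by rewrite [2 ^ t.+4]expnS; lia.
Qed.

Theorem theorem4p11 (t : nat) (G : sgraph) (ht : 2 <= t)
    (hG : induced_minimal G (star t)) :
  #|G| <= (t ^ 2 - 1) * (2 ^ t.+1 - t - 3) + 2 * t + 2.
Proof.
have [[K Km [h hb he]] _] := hG.
have tr := tracked_start hG.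
have emb_id : embeds (@edge G) (id : G -> G) by split.
have [e [X [g [{}tr [gi ge]]]]] := pivot_minor_tracked Km tr emb_id.
have [h' hK h'K] := hb.
have : embeds e (g \o h').
  split=> [x y /gi /(can_inj h'K) //|x y].
  by rewrite /= -ge -he !h'K.
case/embeds_star => c [L [st tL]].
apply: leq_trans (tracked_card_bound ht tr st tL) _.
have := exp2_large ht; move: (2 ^ _) => N tN.
have -> : N - 2 = (N - t - 3) + t.+1 by lia.
have : 3 <= N - t - 3 by lia.
move: (N - t - 3) => Q Q3 {tN}.
(* This amounts to [t^2 - 1 <= (t^2 - t - 1) * Q]; [Q >= 3] suffices because
   [(2t + 1)(t - 2) >= 0]. *)
nia.
Qed.
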